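(* Let $k\ge1$, let $G$ and $G'$ be graphs without isolated vertices, and let $v\in V(G)$. Suppose that: (a1) $M_k(G)$ is a connected matroid; (a2) $S(x,G)$ is a non-separating cocircuit of $M_k(G)$ for every vertex $x$ of $G$ except for the one vertex $v$ (i.e. for every $x\in V(G)\setminus\{v\}$); (a3) every loop of $G$ is incident to $v$; (a4) $s(v,G)\le\rho^*_k(G)+1$ and $G\setminus v$ has no tree component; (a5) $M_k(G')=M_k(G)$. Then $\mathcal{S}(G)=\mathcal{S}(G')$, i.e. $G$ and $G'$ are strongly isomorphic.
   Context: Graphs are finite and may have loops and parallel edges. For $X\subseteq E(G)$, $G\langle X\rangle$ is the subgraph of $G$ with edge set $X$ whose vertices are the end-vertices of edges in $X$. $\Delta G=|E(G)|-|V(G)|$. $\mathcal{G}_{\bowtie}$ is the set of graphs having no isolated vertices, no leaves (vertices of degree 1, a loop contributing 2 to the degree), and no cycle components (components that are cycles; a vertex with a single loop is a cycle, and two parallel edges form a cycle). For $k\ge1$ the $k$-circular matroid $M_k(G)$ is the matroid on $E(G)$ whose circuits are the sets $C\subseteq E(G)$ with $\Delta G\langle C\rangle=k$ and $G\langle C\rangle\in\mathcal{G}_{\bowtie}$ (these are known to be the circuits of a matroid). $\rho^*_k(G)$ is the corank of $M_k(G)$, i.e. $|E(G)|$ minus the rank of $M_k(G)$. Equality $M_k(G)=M_k(G')$ means equality of ground sets $E(G)=E(G')$ and of the families of circuits. A matroid is connected if its ground set is nonempty, it has no loops and no coloops, and every two elements belong to a common circuit. A cocircuit $K$ of a connected matroid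 $M$ is non-separating if the deletion $M\setminus K$ is a connected matroid. $G\setminus x$ is $G$ with vertex $x$ and all edges incident to it deleted. A tree component is a component that is a tree; an isolated vertex counts as a tree. $S(x,G)$ is the set of edges of $G$ incident to $x$ (loops included), $s(x,G)=|S(x,G)|$, and $\mathcal{S}(G)=\{S(x,G):x\in V(G)\}$. Graphs $G=(V,E,\phi)$ and $G'=(V',E,\phi')$ with the same edge set are strongly isomorphic if there is a bijection $\nu:V\to V'$ such that for each edge $e$: $\phi(e)=\{x,y\}\Leftrightarrow\phi'(e)=\{\nu(x),\nu(y)\}$, where $\phi(e)$ is the set of end-vertices of $e$. *)

(* Defs.v *)
From mathcomp Require Import all_boot all_order all_algebra.

Set Implicit Arguments.
Unset Strict Implicit.
Unset Printing Implicit Defensive.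

(* A graph has vertices in an ambient finite type V and edges in an ambient
   finite type E.  [ends e] is the set of end-vertices of e, a singleton exactly
   when e is a loop; its value is irrelevant when e is not in [eset]. *)
Record graph (V E : finType) := Graph {
  vset : {set V};
  eset : {set E};
  ends : E -> {set V};
  ends_sub : forall e, e \in eset -> ends e \subset vset;
  ends_card : forall e, e \in eset -> 0 < #|ends e| <= 2
}.

Section Graphs.
Variables V E : finType.
Implicit Types (G : graph V E) (x y : V) (e : E) (X : {set E}) (A : {set V}).

Definition is_loop G e := (e \in eset G) && (#|ends G e| == 1).

Definition star x G : {set E} := [set e in eset G | x \in ends G e].

Definition stars G : {set {set E}} := [set star x G | x in vset G].

Definition degree G x : nat :=
  #|[set e in star x G | ~~ is_loop G e]|
    + 2 * #|[set e in star x G | is_loop G e]|.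

Definition no_isolated G := [forall x in vset G, degree G x != 0].

Definition no_leaf G := [forall x in vset G, degree G x != 1].

Definition Delta G : int := (#|eset G|%:Z - #|vset G|%:Z)%R.

Lemma edge_subgraph_sub G X e : e \in eset G :&: X ->
  ends G e \subset \bigcup_(f in eset G :&: X) ends G f.
Proof. by move=> eX; apply: bigcup_sup. Qed.

Lemma edge_subgraph_card G X e : e \in eset G :&: X -> 0 < #|ends G e| <= 2.
Proof. by case/setIP => /ends_card. Qed.

(* G<X> *)
Definition edge_subgraph G X : graph V E :=
  Graph (@edge_subgraph_sub G X) (@edge_subgraph_card G X).

Lemma induced_sub G A e : e \in [set e in eset G | ends G e \subset A] ->
  ends G e \subset vset G :&: A.
Proof. by rewrite inE subsetI => /andP[/ends_sub -> ->]. Qed.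

Lemma induced_card G A e : e \in [set e in eset G | ends G e \subset A] ->
  0 < #|ends G e| <= 2.
Proof. by rewrite inE => /andP[/ends_card]. Qed.

Definition induced G A : graph V E :=
  Graph (@induced_sub G A) (@induced_card G A).

Lemma del_vertex_sub G x e : e \in [set e in eset G | x \notin ends G e] ->
  ends G e \subset vset G :\ x.
Proof. by rewrite inE subsetD1 => /andP[/ends_sub -> ->]. Qed.

Lemma del_vertex_card G x e : e \in [set e in eset G | x \notin ends G e] ->
  0 < #|ends G e| <= 2.
Proof. by rewrite inE => /andP[/ends_card]. Qed.

Definition del_vertex G x : graph V E :=
  Graph (@del_vertex_sub G x) (@del_vertex_card G x).

Definition adj G : rel V :=
  fun x y => [exists e in eset G, (x \in ends G e) && (y \in ends G e)].

Definition connected_graph G :=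
  (vset G != set0) && [forall x in vset G, forall y in vset G, connect (adj G) x y].

(* The component containing x; meaningful when x is a vertex of G. *)
Definition component G x : graph V E :=
  induced G [set y | connect (adj G) x y].

Definition is_cycle G :=
  connected_graph G && [forall x in vset G, degree G x == 2].

Definition is_tree G :=
  connected_graph G &&
  [forall X : {set E}, (X \subset eset G) ==> ~~ is_cycle (edge_subgraph G X)].

Definition no_cycle_component G :=
  [forall x in vset G, ~~ is_cycle (component G x)].

Definition no_tree_component G :=
  [forall x in vset G, ~~ is_tree (component G x)].

Definition bowtie G := [&& no_isolated G, no_leaf G & no_cycle_component G].

End Graphs.

Definition strongly_isomorphic (V V' E : finType)
    (G : graph V E) (G' : graph V' E) : Prop :=
  eset G = eset G' /\
  exists nu : {x | x \in vset G} -> {x | x \in vset G'},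
    bijective nu /\
    forall e x y, e \in eset G ->
      ends G e = [set val x; val y] <-> ends G' e = [set val (nu x); val (nu y)].

(* A matroid is presented by its ground set and its family of circuits, so that
   Leibniz equality is equality of both.  The circuit axioms are not bundled:
   the notions below only read off the circuits. *)
Record matroid (E : finType) := Matroid {
  ground : {set E};
  circuits : {set {set E}}
}.

Section Matroids.
Variable E : finType.
Implicit Types (M : matroid E) (I B K X : {set E}) (e f : E).

Definition indep M I :=
  (I \subset ground M) && [forall C in circuits M, ~~ (C \subset I)].

Definition basis M B := maxset (indep M) B.

Definition rank M : nat := \max_(I : {set E} | indep M I) #|I|.

Definition corank M : nat := #|ground M| - rank M.

Definition coindep M X := [exists B, basis M B && (X \subset ground M :\: B)].

Definition dual M : matroid E :=
  Matroid (ground M)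
    [set K | minset (fun X => (X \subset ground M) && ~~ coindep M X) K].

Definition cocircuits M := circuits (dual M).

Definition mloop M e := [set e] \in circuits M.

Definition coloop M e := mloop (dual M) e.

Definition deletion M K : matroid E :=
  Matroid (ground M :\: K) [set C in circuits M | C \subset ground M :\: K].

Definition connected_matroid M : Prop :=
  [/\ ground M != set0,
      forall e, e \in ground M -> ~~ mloop M e,
      forall e, e \in ground M -> ~~ coloop M e
    & forall e f, e \in ground M -> f \in ground M -> e != f ->
        exists2 C, C \in circuits M & (e \in C) && (f \in C)].

Definition nonseparating_cocircuit M K : Prop :=
  K \in cocircuits M /\ connected_matroid (deletion M K).

End Matroids.

Definition circular_matroid (k : nat) (V E : finType) (G : graph V E) : matroid E :=
  Matroid (eset G)
    [set C : {set E} | [&& C \subset eset G,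
                           Delta (edge_subgraph G C) == k%:Z%R
                         & bowtie (edge_subgraph G C)]].

(* Main.v *)
Require Import Defs.
From mathcomp Require Import all_boot all_order all_algebra.
From mathcomp Require Import zify.

(* A set [I] of edges is independent in M_k(G) iff #|X| < #|V(X)| + k for every
   X \subset I.  As X |-> #|V(X)| is submodular, sets attaining
   #|X| + 1 = #|V(X)| + k are closed under union, and it follows that a
   restriction of M_k(G) to a nonempty set H without coloops has rank
   #|V(H)| + k - 1.  Hence a non-separating cocircuit K leaves exactly one vertex x
   outside V(E \ K) and equals the star of x.  Applied to G', this matches every
   vertex x != v of G with a vertex of G' having the same star; one vertex v' of G'
   is left over, and its star is contained in the star of v.  If the inclusion
   were strict, A = E \ star(v') would have rank at most #|V| + k - 2 in M_k(G'),
   because A misses v'.  In G, however, A contains G \ v and an edge joining v to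
   another vertex, so every component of (V, A) contains a cycle, and
   #|A| >= #|V| + k - 1, so that A has full rank #|V| + k - 1 in M_k(G). *)

Set Implicit Arguments.
Unset Strict Implicit.
Unset Printing Implicit Defensive.

(** * Degree counting and cycles *)

Section Handshake.
Variables V E : finType.
Implicit Types G : graph V E.

Lemma handshake G : \sum_(x in vset G) degree G x = 2 * #|eset G|.
Proof.
(* A loop has a single end, so weight 2 makes [#|ends G e| * w e = 2] for every edge, and exchanging
   the sums counts each edge twice. *)
pose w e := if is_loop G e then 2 else 1.
have degE x : degree G x = \sum_(e in eset G | x \in ends G e) w e.
  rewrite (bigID (is_loop G)) /= addnC /degree mulnC -sum1_card -sum_nat_const.
  congr (_ + _); apply: eq_big => e; rewrite ?inE //.
    by case/andP=> _ /negPf eNloop; rewrite /w eNloop.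
  by case/andP=> _ eloop; rewrite /w eloop.
rewrite (eq_bigr _ (fun x _ => degE x)) (exchange_big_dep (mem (eset G))) /=;
  last by move=> x e _ /andP[].
rewrite mulnC -sum_nat_const; apply: eq_bigr => e eG.
rewrite sum_nat_const.
have -> : #|[pred x in vset G | (e \in eset G) && (x \in ends G e)]| = #|ends G e|.
  apply: eq_card => x; rewrite !inE eG /=.
  by case xe: (x \in ends G e); rewrite ?andbF // (subsetP (ends_sub eG)).
by rewrite /w /is_loop eG /=; have := ends_card eG; case: eqP; lia.
Qed.

Lemma cycle_card G : is_cycle G -> #|eset G| = #|vset G| /\ 0 < #|vset G|.
Proof.
case/andP => /andP[G0 _] /'forall_implyP deg2; rewrite card_gt0 G0; split=> //.
have := handshake G.
rewrite (eq_bigr (fun=> 2)) => [|x xG]; last exact/eqP/deg2.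
by rewrite sum_nat_const; lia.
Qed.

End Handshake.

(** * The counting description of independence, and tight sets *)

Section Sparse.
Variables V E : finType.
Variable G : graph V E.
Variable k : nat.
Implicit Types (X Y B C T H : {set E}) (e f : E) (x y : V).

Definition verts X : {set V} := vset (edge_subgraph G X).

Lemma mem_verts X x :
  reflect (exists2 e, e \in eset G :&: X & x \in ends G e) (x \in verts X).
Proof. exact: bigcupP. Qed.

Lemma ends_verts X e : e \in eset G -> e \in X -> ends G e \subset verts X.
Proof. by move=> eG eX; apply/edge_subgraph_sub/setIP. Qed.

Lemma vertsS X Y : X \subset Y -> verts X \subset verts Y.
Proof.
move=> sXY; apply/subsetP => x /mem_verts[e /setIP[eG eX] xe].
by apply/mem_verts; exists e; rewrite // inE eG (subsetP sXY).
Qed.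

Lemma vertsU X Y : verts (X :|: Y) = verts X :|: verts Y.
Proof.
apply/eqP; rewrite eqEsubset subUset !vertsS ?subsetUl ?subsetUr // !andbT.
apply/subsetP => x /mem_verts[e /setIP[eG]]; rewrite !inE => /orP[] eX xe.
  by rewrite (subsetP (ends_verts eG eX)).
by rewrite (subsetP (ends_verts eG eX)) ?orbT.
Qed.

(** Submodularity of the vertex count. It is an inequality because a vertex shared by [X] and [Y]
    need not lie on a common edge. *)
Lemma card_vertsUI X Y :
  #|verts (X :|: Y)| + #|verts (X :&: Y)| <= #|verts X| + #|verts Y|.
Proof.
rewrite vertsU -(cardsUI (verts X)) leq_add2l subset_leq_card // subsetI.
by rewrite !vertsS ?subsetIl ?subsetIr.
Qed.

Lemma verts_subset X : verts X \subset vset G.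
Proof.
apply/subsetP => x /mem_verts[e /setIP[eG _]].
exact/subsetP/ends_sub.
Qed.

Lemma ends_neq0 e : e \in eset G -> exists x, x \in ends G e.
Proof. by move/ends_card => /andP[/card_gt0P]. Qed.

(** The empty [Y] is included, so the condition forces [0 < k]; this lets the bound be applied to
    intersections without checking that they are nonempty. *)
Definition sparse X := [forall Y : {set E}, (Y \subset X) ==> (#|Y| < #|verts Y| + k)].

Lemma sparseP X :
  reflect (forall Y, Y \subset X -> #|Y| < #|verts Y| + k) (sparse X).
Proof. exact: 'forall_implyP. Qed.

Lemma sparseS X Y : X \subset Y -> sparse Y -> sparse X.
Proof.
move=> sXY /sparseP spY; apply/sparseP => Z sZX.
exact/spY/(subset_trans sZX).
Qed.

Lemma Delta_edge_subgraph C : C \subset eset G ->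
  (Delta (edge_subgraph G C) == k%:Z%R) = (#|C| == #|verts C| + k).
Proof.
have -> : Delta (edge_subgraph G C) = (#|eset G :&: C|%:Z - #|verts C|%:Z)%R by [].
move/setIidPr->; apply/eqP/eqP; lia.
Qed.

Lemma circuit_not_sparse C :
  C \in circuits (circular_matroid k G) -> ~~ sparse C.
Proof.
rewrite inE => /and3P[sCG]; rewrite Delta_edge_subgraph // => /eqP cC _.
by apply/negP => /sparseP/(_ C (subxx C)); rewrite cC ltnn.
Qed.

(* A minimal set violating the count is a circuit: a leaf edge or a cycle
   component could be removed without decreasing [#|C| - #|verts C|]. *)
Lemma min_dense_circuit C : 0 < k -> C \subset eset G ->
  minset (fun X => #|verts X| + k <= #|X|) C ->
  C \in circuits (circular_matroid k G).
Proof.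
move=> k_gt0 sCG /minsetP[/= dC minC].
have smaller X : X \subset C -> X != set0 ->
    #|verts (C :\: X)| + #|X| <= #|verts C| -> False.
  move=> sXC X0 cX; have := cardsID X C; rewrite (setIidPr sXC) => cC.
  have CXC : C :\: X = C by apply: minC; [lia | rewrite subsetDl].
  by case/negP: X0; rewrite -cards_eq0; move: cC; rewrite CXC; lia.
set Q := edge_subgraph G C.
rewrite inE sCG Delta_edge_subgraph //=; apply/andP; split.
  have [|[e eC]] := set_0Vmem C; first by move=> C0; move: dC; rewrite C0 cards0; lia.
  (* If [C] exceeded the count, it would still reach it after losing the edge [e], against
     minimality. *)
  have e1: #|C| <= #|verts C| + k.
    have := cardsD1 e C; rewrite eC => cC.
    have := subset_leq_card (vertsS (subsetDl C [set e])) => cV.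
    rewrite leqNgt; apply/negP => ltC.
    have CeC : C :\ e = C by apply: minC; [lia | rewrite subsetDl].
    by have := setD11 e C; rewrite CeC eC.
  by rewrite eqn_leq e1.
apply/and3P; split.
- apply/'forall_implyP => x /mem_verts[e /setIP[eG eC] xe].
  rewrite /degree -lt0n addn_gt0 muln_gt0 /= !card_gt0.
  case: (boolP (is_loop Q e)) => le; apply/orP; [right|left];
    by apply/set0Pn; exists e; rewrite !inE le /= eG eC xe.
- apply/'forall_implyP => x xQ; apply/negP => /eqP.
  rewrite -/Q => deg1.
  have /cards1P[e S1] : #|[set e in star x Q | ~~ is_loop Q e]| == 1.
    by move: deg1; rewrite /degree; move: #|_| #|_|; lia.
  have S0 : [set e in star x Q | is_loop Q e] = set0.
    by apply: cards0_eq; move: deg1; rewrite /degree; lia.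
  have Sx f : f \in star x Q -> f = e.
    move=> fx; case: (boolP (is_loop Q f)) => lf.
      by have := in_set0 f; rewrite -S0 inE fx lf.
    by apply/set1P; rewrite -S1 inE fx lf.
  have : e \in star x Q by have := set11 e; rewrite -S1 inE => /andP[].
  rewrite inE => /andP[eQ xe].
  apply: (smaller [set e]); rewrite ?sub1set ?(subsetP (subsetIr (eset G) C)) //.
    by apply/set0Pn; exists e; rewrite set11.
  rewrite cards1 addn1 (cardsD1 x (verts C)) xQ ltnS subset_leq_card //.
  rewrite subsetD1 vertsS ?subsetDl //=; apply/mem_verts => -[f /setIP[fG]].
  rewrite !inE => /andP[fe fC] xf; case/eqP: fe; apply: Sx.
  by rewrite !inE fG fC.
- apply/'forall_implyP => x xQ; apply/negP => /cycle_card[].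
  set D := eset _; set W := vset _ => cD W0.
  have sDC : D \subset C by apply/subsetP => e; rewrite !inE => /andP[/andP[]].
  apply: (smaller D) => //; first by rewrite -card_gt0 cD.
  have sWC : W \subset verts C by apply: subsetIl.
  rewrite cD -(cardsID W (verts C)) (setIidPr sWC) addnC leq_add2l.
  (* The remaining edges avoid [W]: an edge of [C] with an end in the component belongs to the
     component. *)
  rewrite subset_leq_card // subsetD vertsS ?subsetDl //=.
  rewrite disjoint_subset; apply/subsetP => y /mem_verts[e /setIP[eG /setDP[eC eD]] ye].
  apply: contra eD; rewrite !inE eG eC /= => /andP[_ xy].
  apply/subsetP => z ze; rewrite inE (connect_trans xy) // connect1 //.
  by apply/'exists_and3P; exists e; rewrite !inE eG eC ye ze.
Qed.

(** A circuit violates the count, and any set violating it contains a minimal such set, which is a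
    circuit. No matroid axiom enters. *)
Lemma indep_circular I : 0 < k ->
  indep (circular_matroid k G) I = (I \subset eset G) && sparse I.
Proof.
move=> k_gt0; rewrite /indep /=; case: (boolP (I \subset eset G)) => //= sIG.
apply/'forall_implyP/sparseP => [noC Y sYI|spI C circ]; last first.
  apply/negP => sCI; case/negP: (circuit_not_sparse circ).
  exact/(sparseS sCI)/sparseP.
rewrite ltnNge; apply/negP => dY.
have [C minC sCY] := @minset_exists _ (fun X => #|verts X| + k <= #|X|) _ dY.
have sCI := subset_trans sCY sYI.
by have /negP[] := noC C (min_dense_circuit k_gt0 (subset_trans sCI sIG) minC).
Qed.

Lemma sparsePn X :
  reflect (exists2 Y : {set E}, Y \subset X & #|verts Y| + k <= #|Y|) (~~ sparse X).
Proof.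
apply: (iffP forall_inPn) => [[Y] | [Y sYX dY]].
  by rewrite -leqNgt; exists Y.
by exists Y; rewrite // -leqNgt.
Qed.

Definition tight X := #|X|.+1 == #|verts X| + k.

(** Submodularity, with the sparse bound on [X :&: Y], forces [X :|: Y] up to the largest size
    allowed inside [B]. *)
Lemma tightU B X Y : sparse B -> X \subset B -> Y \subset B ->
  tight X -> tight Y -> tight (X :|: Y).
Proof.
move=> /sparseP spB sXB sYB /eqP tX /eqP tY; rewrite /tight eqn_leq spB ?subUset ?sXB //.
have := spB (X :&: Y) (subset_trans (subsetIl _ _) sXB).
by have := cardsUI X Y; have := card_vertsUI X Y; lia.
Qed.

(** A subset [Y] of [e |: B] violating the count contains [e], and [Y :\ e] obeys it. One edge makes
    the difference, so [Y :\ e] is tight and already covers all vertices of [Y]. *)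
Lemma tight_span B e : e \in eset G -> e \notin B -> sparse B -> ~~ sparse (e |: B) ->
  exists X, [/\ X \subset B, tight X & ends G e \subset verts X].
Proof.
move=> eG eB /sparseP spB /sparsePn[Y sYB dY].
have eY : e \in Y.
  apply: contraLR dY => eY; rewrite -ltnNge spB //.
  by rewrite -(setU1K eB) subsetD1 sYB.
have sXB : Y :\ e \subset B by rewrite subDset.
have := spB _ sXB; have := cardsD1 e Y; rewrite eY => cY ltX.
have sV : verts (Y :\ e) \subset verts Y by rewrite vertsS ?subsetDl.
have := subset_leq_card sV => leV.
exists (Y :\ e); split=> //; first by apply/eqP; lia.
have -> : verts (Y :\ e) = verts Y by apply/eqP; rewrite eqEcard sV; lia.
exact: ends_verts.
Qed.

(** Each edge of [H :\: B] is spanned by a tight subset of [B]. A maximal tight subset absorbs all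
    of these by [tightU], so one [T] serves every edge. *)
Lemma maximal_sparse_tight H B : H \subset eset G -> H :\: B != set0 -> sparse B ->
    (forall e, e \in H :\: B -> ~~ sparse (e |: B)) ->
  exists T, [/\ T \subset B, tight T & verts (H :\: B) \subset verts T].
Proof.
move=> sHG /set0Pn[e0 e0HB] spB maxB.
have span e : e \in H :\: B ->
    exists X, [/\ X \subset B, tight X & ends G e \subset verts X].
  move=> eHB; have /setDP[eH eB] := eHB.
  by apply: tight_span (maxB e eHB); rewrite ?(subsetP sHG).
have [X0 [sX0 tX0 _]] := span e0 e0HB.
have [|T /maxsetP[/andP[sTB tT] maxT] _] :=
  @maxset_exists _ (fun X => (X \subset B) && tight X) X0; first by rewrite sX0.
exists T; split=> //; apply/subsetP => x /mem_verts[e /setIP[eG eHB] xe].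
have [X [sXB tX eX]] := span e eHB.
rewrite -(maxT (T :|: X)) ?subsetUl ?subUset ?sTB ?sXB ?(tightU spB) //.
by rewrite vertsU inE (subsetP eX) ?orbT.
Qed.

End Sparse.

(** * Deletions and coloops for matroids given by circuits *)

Section Matroids.
Variable E : finType.
Implicit Types (N : matroid E) (I B K : {set E}) (e : E).

Lemma indep_deletion N K I :
  indep (deletion N K) I = (I \subset ground N :\: K) && indep N I.
Proof.
rewrite /indep /=; case: (boolP (I \subset _)) => //= sI.
rewrite (subset_trans sI (subsetDl _ _)) /=.
apply/'forall_implyP/'forall_implyP => noC C.
  move=> CN; apply/negP => sCI.
  by have /noC/negP[] : C \in circuits (deletion N K) by rewrite inE CN (subset_trans sCI).
by rewrite inE => /andP[/noC].
Qed.

(** If every basis contained [e], then [[set e]] would be minimal among sets that are not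
    coindependent, hence a coloop; the empty set is coindependent because some basis exists. *)
Lemma basis_avoiding N e : indep N set0 -> connected_matroid N -> e \in ground N ->
  exists2 B, basis N B & e \notin B.
Proof.
move=> ind0 [_ _ nocoloop _] eN; case: (boolP [exists B, basis N B && (e \notin B)]).
  by case/existsP => B /andP[]; exists B.
rewrite negb_exists => /forallP allB; case/negP: (nocoloop e eN).
rewrite /coloop /mloop inE; apply/minsetP; split.
  rewrite sub1set eN /=; apply/existsPn => B; have := allB B.
  by rewrite sub1set inE eN andbT.
move=> Y /andP[_ ncoY]; rewrite subset1 => /orP[/eqP-> // | /eqP Y0].
case/negP: ncoY; have [B maxB _] := maxset_exists ind0.
by apply/existsP; exists B; rewrite /basis maxB Y0 sub0set.
Qed.

End Matroids.

(** * Rank of connected restrictions, and non-separating cocircuits as stars *)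

Section Cocircuits.
Variables V E : finType.
Variable G : graph V E.
Variable k : nat.
Hypothesis k_gt0 : 0 < k.
Implicit Types (N : matroid E) (X Y B C T H : {set E}) (e f : E) (x y : V).

Lemma sparse0 : sparse G k set0.
Proof.
by apply/sparseP => Y; rewrite subset0 => /eqP->; rewrite cards0 addn_gt0 k_gt0 orbT.
Qed.

(* Off the tight set [T] spanning the complement of [B], every element of [B]
   would be a coloop of [N]: a dependent set [C] through it has more edges
   leaving [verts T] than vertices outside [verts T]. *)
Lemma card_basis N B : ground N \subset eset G ->
    (forall I : {set E}, indep N I = (I \subset ground N) && sparse G k I) ->
    connected_matroid N -> basis N B ->
  #|B|.+1 = #|verts G (ground N)| + k.
Proof.
set H := ground N => sHG indN conN basB.
have ind0 : indep N set0 by rewrite indN sub0set sparse0.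
have max_sparse D : basis N D ->
    [/\ D \subset H, sparse G k D & forall e, e \in H :\: D -> ~~ sparse G k (e |: D)].
  case/maxsetP; rewrite indN => /andP[sDH spD] maxD; split=> // e /setDP[eH eD].
  apply: contra eD => spe; rewrite -(maxD (e |: D)) ?setU11 ?subsetUr //.
  by rewrite indN spe subUset sub1set eH sDH.
have [sBH spB maxB] := max_sparse B basB.
(* If [B] were all of [H], every basis would equal [B] by maximality, leaving none that avoids a
   given element of [H]. *)
have HB : H :\: B != set0.
  apply/negP; rewrite setD_eq0 => sHB; have [/set0Pn[e eH] _ _ _] := conN.
  have [D basD eD] := basis_avoiding ind0 conN eH; case/negP: eD.
  have [sDH _ _] := max_sparse D basD; case/maxsetP: basD => _ maxD.
  rewrite -(maxD B) ?(subset_trans sDH) ?(subsetP sHB) //.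
  by case/maxsetP: basB.
have [T [sTB tT sVT]] := maximal_sparse_tight sHG HB spB maxB.
suff BT : B = T.
  move: tT sVT; rewrite -BT => /eqP-> sVB; suff -> : verts G H = verts G B by [].
  apply/eqP; rewrite eqEsubset -{1}(setID H B) vertsU subUset.
  by rewrite sVB (vertsS G (subsetIr H B)) vertsS.
apply/eqP; rewrite eqEsubset sTB andbT; apply/negP => /negP/subsetPn[c cB cT].
have cH := subsetP sBH c cB.
have [D basD cD] := basis_avoiding ind0 conN cH.
have [sDH spD maxD] := max_sparse D basD.
have := maxD c; rewrite inE cD cH => /(_ isT)/sparsePn[C' sC'D dC'].
have [C] := @minset_exists _ (fun X => #|verts G X| + k <= #|X|) _ dC'.
case/minsetP => dC minC sCC'; have sCD := subset_trans sCC' sC'D.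
have sCH : C \subset H by apply: subset_trans sCD _; rewrite subUset sub1set cH.
(* Edges of [H :\: B] have their ends in [verts G T], so those of [C] outside [C0] lie in [B] and
   off [T]. The edge [c] is added to [Z] since it may belong to [C0] while lying off [T]. *)
pose C0 := [set e in C | ends G e \subset verts G T].
pose Z := c |: C :\: C0; pose W := verts G C :\: verts G T.
have cC : c \in C.
  apply: contraLR dC => cC; rewrite -ltnNge; move/sparseP: spD; apply.
  by rewrite -(setU1K cD) subsetD1 sCD.
have sVC0 : verts G C0 \subset verts G C :&: verts G T.
  rewrite subsetI vertsS; last by apply/subsetP => e; rewrite inE => /andP[].
  apply/subsetP => x /mem_verts[e /setIP[eG]]; rewrite inE => /andP[_ eT].
  exact: subsetP.
have ZP e : e \in Z -> (e \in B) && (e \notin T).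
  rewrite in_setU1 => /orP[/eqP->|]; first by rewrite cB.
  case/setDP => eC; rewrite inE eC /= => eT.
  have eH := subsetP sCH e eC; have eG := subsetP sHG e eH.
  apply/andP; split; last by apply: contra eT; apply: ends_verts.
  apply: contraR eT => eB.
  by apply: subset_trans sVT; apply: ends_verts; rewrite // inE eB.
(* [T] is tight and [T :|: Z] is sparse, so each edge of [Z] must be paid for by a vertex outside
   [verts G T]. *)
have cZ : #|Z| <= #|W|.
  have : #|T :|: Z| < #|verts G (T :|: Z)| + k.
    move/sparseP: spB; apply; rewrite subUset sTB.
    by apply/subsetP => e /ZP/andP[].
  have -> : #|T :|: Z| = #|T| + #|Z|.
    rewrite cardsU (_ : T :&: Z = set0) ?cards0 ?subn0 //.
    apply/setP => e; rewrite in_setI in_set0; apply/negP => /andP[eT /ZP].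
    by rewrite eT andbF.
  have : #|verts G (T :|: Z)| <= #|verts G T| + #|W|.
    rewrite -(cardsID (verts G T) (verts G (T :|: Z))) leq_add //.
      by rewrite subset_leq_card ?subsetIr.
    rewrite subset_leq_card // vertsU setDUl setDv set0U setSD // vertsS //.
    by rewrite subUset sub1set cC subsetDl.
  by move/eqP: tT; clear -k; lia.
have cW := cardsID (verts G T) (verts G C); rewrite -/W in cW.
have cC0 := subset_leq_card sVC0.
(* If [C0 = C], then [W] is empty although [Z] contains [c]. Otherwise minimality of [C] puts [C0]
   below the count, so [C :\: C0] has more than [#|W|] edges. *)
have [C0C | C0C] := eqVneq C0 C.
  have : 0 < #|Z| by rewrite card_gt0; apply/set0Pn; exists c; rewrite setU11.
  by rewrite C0C in cC0; move: cZ cC0 cW; clear -k; lia.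
have sC0C : C0 \subset C by apply/subsetP => e; rewrite inE => /andP[].
have := cardsID C0 C; rewrite (setIidPr sC0C) => cC1.
have leZ : #|C :\: C0| <= #|Z| by rewrite subset_leq_card ?subsetUr.
have [/(minC C0)/(_ sC0C)/eqP | ltC0] := leqP (#|verts G C0| + k) #|C0|.
  by rewrite (negPf C0C).
by move: cZ leZ cC1 ltC0 cC0 cW dC => /=; clear -k; lia.
Qed.

Hypothesis G_no_isolated : no_isolated G.
Hypothesis conM : connected_matroid (circular_matroid k G).
Let M := circular_matroid k G.

Lemma mem_star x e : (e \in star x G) = (e \in eset G) && (x \in ends G e).
Proof. by rewrite inE. Qed.

Lemma verts_eset : verts G (eset G) = vset G.
Proof.
apply/eqP; rewrite eqEsubset verts_subset; apply/subsetP => x xG.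
have := implyP (forallP G_no_isolated x) xG; rewrite /degree -lt0n addn_gt0 muln_gt0 /=.
by case/orP => /card_gt0P[e]; rewrite in_set mem_star => /andP[/andP[eG xe] _];
  apply: (subsetP (ends_verts eG eG)).
Qed.

Lemma indepM I : indep M I = (I \subset ground M) && sparse G k I.
Proof. exact: indep_circular. Qed.

Lemma indep0M : indep M set0.
Proof. by rewrite indepM sub0set sparse0. Qed.

Lemma card_basis_circular B : basis M B -> #|B|.+1 = #|vset G| + k.
Proof. by move/(card_basis (N := M) (subxx _) indepM conM) ->; rewrite verts_eset. Qed.

Lemma card_sparse_circular B : sparse G k B -> #|B| < #|vset G| + k.
Proof.
move/sparseP/(_ B (subxx B)) => /leq_trans; apply.
by rewrite leq_add2r subset_leq_card ?verts_subset.
Qed.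

Lemma sparse_basis B : B \subset eset G -> sparse G k B -> #|vset G| + k <= #|B|.+1 ->
  basis M B.
Proof.
move=> sBG spB leB; apply/maxsetP; rewrite indepM sBG spB; split=> // D.
rewrite indepM => /andP[_ /card_sparse_circular ltD] sBD.
by apply/esym/eqP; rewrite eqEcard sBD; lia.
Qed.

Lemma rank_circular : (rank M).+1 = #|vset G| + k.
Proof.
have [B basB _] := maxset_exists indep0M.
apply/eqP; rewrite eqn_leq; apply/andP; split.
  have -> : #|vset G| + k = (#|vset G| + k).-1.+1 by lia.
  rewrite ltnS; apply/bigmax_leqP => I; rewrite indepM => /andP[_].
  by move/card_sparse_circular; lia.
rewrite -(card_basis_circular basB) ltnS.
by apply: (bigmax_sup B) => //; case/maxsetP: basB.
Qed.

(** Let [H] be the complement of [K]. It contains no basis of [M], so by [card_basis] it misses a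
    vertex; by minimality of [K], adding any edge of [K] restores full rank, so it misses only one,
    and that edge must reach it. *)
Lemma nonseparating_cocircuit_star K : nonseparating_cocircuit M K ->
  exists x, [/\ x \in vset G, K = star x G & verts G (eset G :\: K) = vset G :\ x].
Proof.
case; rewrite inE => /minsetP[/andP[/= sKG ncoK] minK] conH.
set H := eset G :\: K in conH *.
have sHG : H \subset eset G := subsetDl _ _.
have meetK B : basis M B -> ~~ (B \subset H).
  move=> basB; apply: contra ncoK => sBH; apply/existsP; exists B.
  rewrite basB subsetD sKG /=.
  by move: sBH; rewrite subsetD disjoint_sym => /andP[].
have indH I : indep (deletion M K) I = (I \subset H) && sparse G k I.
  rewrite indep_deletion indepM /=; case: (boolP (I \subset _)) => //= sIH.
  by rewrite (subset_trans sIH).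
have [B basB _] : {B | basis (deletion M K) B & set0 \subset B}.
  by apply: maxset_exists; rewrite indH sub0set sparse0.
have cB : #|B|.+1 = #|verts G H| + k := card_basis (N := deletion M K) sHG indH conH basB.
have /andP[sBH spB] : (B \subset H) && sparse G k B by rewrite -indH; case/maxsetP: basB.
have ltH : #|verts G H| < #|vset G|.
  rewrite ltnNge; apply/negP => leGH.
  have /meetK/negP[] // : basis M B.
  by apply: sparse_basis => //; [exact: subset_trans sHG | rewrite cB leq_add2r].
(* Minimality of [K] makes [K :\ e] coindependent, so a basis of [M] avoids it. *)
have extend e : e \in K -> exists2 D, basis M D & D \subset e |: H.
  move=> eK; case: (boolP (coindep M (K :\ e))) => [/existsP[D /andP[basD]] | nco].
    rewrite subsetD => /andP[_ disD]; exists D => //.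
    have : D \subset eset G by case/maxsetP: basD; rewrite indepM => /andP[].
    move=> sDG; apply/subsetP => f fD; rewrite !inE (subsetP sDG f fD) andbT.
    by have := disjointFl disD fD; rewrite !inE; case: (f == e) => //= ->.
  have := minK (K :\ e); rewrite nco (subset_trans (subsetDl _ _) sKG) subsetDl.
  by move/(_ isT isT)/setP/(_ e); rewrite !inE eqxx eK.
have [K0 | [e0 e0K]] := set_0Vmem K.
  by move: ltH; rewrite /H K0 setD0 verts_eset ltnn.
have cH : #|vset G| = #|verts G H|.+1.
  have [D basD sDH] := extend e0 e0K; have := card_basis_circular basD.
  have sXH : D :\ e0 \subset H by rewrite subDset.
  have := subset_leq_card (vertsS G sXH).
  have : #|D :\ e0| < #|verts G (D :\ e0)| + k.
    case/maxsetP: basD; rewrite indepM => /andP[_ /sparseP spD] _.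
    by apply: spD; apply: subsetDl.
  have := cardsD1 e0 D; move: ltH; clear -k; case: (e0 \in D); lia.
have sVH : verts G H \subset vset G := verts_subset G H.
have /cards1P[x Vx] : #|vset G :\: verts G H| == 1.
  by have := cardsID (verts G H) (vset G); rewrite (setIidPr sVH) cH; clear; lia.
have /setDP[xG xH] : x \in vset G :\: verts G H by rewrite Vx set11.
have VH : verts G H = vset G :\ x by rewrite -Vx setDDr setDv set0U (setIidPr sVH).
exists x; split=> //; apply/setP => e; rewrite mem_star; apply/idP/andP => [eK | [eG xe]].
  have eG := subsetP sKG e eK; split=> //; apply: contraLR ltH => xe.
  have eH : ends G e \subset verts G H by rewrite VH subsetD1 xe ends_sub.
  have [D basD sDH] := extend e eK; rewrite -leqNgt -(leq_add2r k).
  rewrite -(card_basis_circular basD).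
  have : #|D| < #|verts G D| + k.
    by case/maxsetP: basD; rewrite indepM => /andP[_ /sparseP spD] _; apply: spD.
  move/leq_trans; apply; rewrite leq_add2r subset_leq_card //.
  apply: subset_trans (vertsS G sDH) _; rewrite vertsU subUset subxx andbT.
  by apply/subsetP => y /mem_verts[f /setIP[_ /set1P->]]; apply: subsetP.
apply: contraR xH => eK; apply: (subsetP (ends_verts (X := H) eG _)) => //.
by rewrite inE eK.
Qed.

End Cocircuits.

(** * Cycles in components and a Hall-type count giving large sparse sets *)

Section Components.
Variables V E : finType.
Implicit Types (G : graph V E) (A B X : {set E}) (W : {set V}) (x y v : V).

Lemma adj_sym G : symmetric (adj G).
Proof. by move=> x y; apply/eq_existsb => e; rewrite (andbC (x \in _)). Qed.

Lemma ends_in_component G x y e :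
  connect (adj G) x y -> e \in eset G -> y \in ends G e -> e \in eset (component G x).
Proof.
move=> xy eG ye; rewrite inE eG; apply/subsetP => z ze; rewrite inE.
apply: connect_trans xy (connect1 _); apply/exists_inP.
by exists e; rewrite // ye ze.
Qed.

Lemma component_connected G x : x \in vset G -> connected_graph (component G x).
Proof.
move=> xG; apply/andP; split.
  by apply/set0Pn; exists x; rewrite !inE xG connect0.
have from_x y : connect (adj G) x y -> connect (adj (component G x)) x y.
  case/connectP => p; elim/last_ind: p y => [|p z IHp] y /=; first by move=> _ ->.
  rewrite rcons_path last_rcons => /andP[xp /exists_inP[e eG /andP[le ze]]] ->.
  apply: connect_trans (IHp _ xp erefl) (connect1 _); apply/exists_inP.
  exists e; last by rewrite le ze.
  by apply: ends_in_component le => //; apply/connectP; exists p.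
apply/'forall_in_'forall_in_idP => y /setIP[_]; rewrite inE => /from_x xy z /setIP[_].
rewrite inE => /from_x; apply: connect_trans.
by rewrite (sym_connect_sym (@adj_sym _)).
Qed.

Lemma component_cycle G x : x \in vset G -> ~~ is_tree (component G x) ->
  exists X, [/\ X \subset eset (component G x), #|verts G X| <= #|X|,
    0 < #|verts G X| & verts G X \subset [set y | connect (adj G) x y]].
Proof.
move=> xG; rewrite /is_tree component_connected //= negb_forall => /existsP[X].
rewrite negb_imply negbK => /andP[sX cycX]; exists X.
have [cX c0] := cycle_card cycX.
have sXG : X \subset eset G.
  by apply: subset_trans sX _; apply/subsetP => e; rewrite inE => /andP[].
have EX : eset (edge_subgraph (component G x) X) = X by apply/setIidPr.
have VX : vset (edge_subgraph (component G x) X) = verts G X.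
  change (\bigcup_(f in eset (component G x) :&: X) ends G f =
          \bigcup_(f in eset G :&: X) ends G f).
  by rewrite (setIidPr sX) (setIidPr sXG).
rewrite VX in cX c0; rewrite EX in cX; split; rewrite ?cX //.
apply/subsetP => y /mem_verts[e /setIP[eG /(subsetP sX)]].
by rewrite inE eG => /subsetP; apply.
Qed.

Lemma ends_three G e x y z : e \in eset G ->
  x \in ends G e -> y \in ends G e -> z \in ends G e -> ~~ uniq [:: x; y; z].
Proof.
move=> eG xe ye ze; apply/negP => /card_uniqP/= c3.
have : {subset [:: x; y; z] <= ends G e}.
  by move=> t; rewrite !inE => /or3P[] /eqP->.
move/subsetP/subset_leq_card; rewrite c3 leqNgt ltnS.
by have /andP[_ ->] := ends_card eG.
Qed.

(** The neighbourhood of [W] in the bipartite incidence graph between vertices and edges of [A]. *)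
Definition touching G A W := [set e in A | ~~ [disjoint ends G e & W]].

Lemma touchingP G A W e :
  reflect (e \in A /\ exists2 x, x \in ends G e & x \in W) (e \in touching G A W).
Proof.
rewrite inE; apply: (iffP andP) => -[eA]; rewrite -setI_eq0.
  by case/set0Pn => x /setIP[xe xW]; split=> //; exists x.
by case=> x xe xW; split=> //; apply/set0Pn; exists x; rewrite inE xe.
Qed.

(* Hall's condition for choosing distinct edges at the vertices of [W]: peel off
   a vertex with an edge leaving [W], or else a whole cycle inside [W]. *)
Lemma card_touching G A : A \subset eset G ->
    (forall W, W != set0 -> W \subset vset G ->
       (forall e, e \in touching G A W -> ends G e \subset W) ->
       exists X, [/\ X \subset A, #|verts G X| <= #|X|,
                     0 < #|verts G X| & verts G X \subset W]) ->
  forall W, W \subset vset G -> #|W| <= #|touching G A W|.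
Proof.
move=> sAG cyc W; have [n] := ubnP #|W|; elim: n => // n IHn in W * => ltWn sWG.
have [->|W0] := eqVneq W set0; first by rewrite cards0.
case: (boolP [forall e in touching G A W, ends G e \subset W]) => [/forall_inP cl|].
  have [X [sXA leX X0 sXW]] := cyc W W0 sWG cl.
  have := cardsID (verts G X) W; rewrite (setIidPr sXW) => cW.
  have leD : #|W :\: verts G X| <= #|touching G A (W :\: verts G X)|.
    apply: IHn; last exact: subset_trans (subsetDl _ _) sWG.
    by move: ltWn cW X0; clear; lia.
  have : [disjoint X & touching G A (W :\: verts G X)].
    rewrite disjoint_subset; apply/subsetP => e eX; rewrite inE.
    apply/touchingP => -[eA [x xe /setDP[_ /negP]]]; apply.
    by apply: (subsetP (ends_verts (subsetP sAG e eA) eX)).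
  rewrite -leq_card_setU => /eqP cU.
  have : X :|: touching G A (W :\: verts G X) \subset touching G A W.
    rewrite subUset; apply/andP; split; apply/subsetP => e.
      move=> eX; have eA := subsetP sXA e eX; have eG := subsetP sAG e eA.
      apply/touchingP; split=> //; have [x xe] := ends_neq0 eG; exists x => //.
      exact: (subsetP sXW) (subsetP (ends_verts eG eX) x xe).
    case/touchingP => eA [x xe /setDP[xW _]].
    by apply/touchingP; split=> //; exists x.
  by move/subset_leq_card; move: leD leX cU cW; clear; lia.
case/forall_inPn => e eW /subsetPn[u ue uW].
have /touchingP[eA [w we wW]] := eW.
have cW := cardsD1 w W; rewrite wW in cW.
have : #|W :\ w| <= #|touching G A (W :\ w)|.
  apply: IHn; last exact: subset_trans (subsetDl _ _) sWG.
  by move: ltWn cW; clear; lia.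
rewrite cW add1n => /leq_ltn_trans; apply; apply: proper_card; apply/properP; split.
  apply/subsetP => f /touchingP[fA [x xf /setD1P[_ xW]]].
  by apply/touchingP; split=> //; exists x.
(* The edge [e] touches [W] only at [w], its other end being [u] outside [W]; removing [w] therefore
   loses [e]. *)
exists e => //; apply/touchingP => -[_ [x xe /setD1P[xw xW]]].
have eG := subsetP sAG e eA; have /negP[] := ends_three eG ue xe we.
by rewrite /= !inE xw !andbT negb_or; apply/andP; split;
  apply: contra uW => /eqP->.
Qed.

(** A nonempty [W] that no edge of [A] leaves contains a vertex other than [v], by the non-loop [a]
    if necessary. It then contains that vertex's whole component in [del_vertex G v], which is not a
    tree and so has a cycle. *)
Lemma card_touching_del_vertex G v a A : A \subset eset G ->
    no_tree_component (del_vertex G v) -> eset (del_vertex G v) \subset A ->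
    a \in A -> v \in ends G a -> ~~ is_loop G a ->
  forall W, W \subset vset G -> #|W| <= #|touching G A W|.
Proof.
move=> sAG notree sDA aA va naloop; apply: card_touching => // W W0 sWG clW.
have [w wW wv] : exists2 w, w \in W & w != v.
  have /set0Pn[w wW] := W0; have [wv|] := eqVneq w v; last by exists w.
  have aG := subsetP sAG a aA.
  have /subsetPn[u ua uv] : ~~ (ends G a \subset [set v]).
    apply: contra naloop => /subset_leq_card; rewrite cards1 /is_loop aG /=.
    by case/andP: (ends_card aG); case: #|_| => [|[]].
  exists u; last by rewrite -in_set1.
  apply: (subsetP (clW a _)) => //; apply/touchingP; split=> //.
  by exists v => //; rewrite -wv.
have wD : w \in vset (del_vertex G v) by rewrite !inE wv (subsetP sWG).
have [X [sX leX X0 sXc]] := component_cycle wD (implyP (forallP notree w) wD).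
have sXD : X \subset eset (del_vertex G v).
  by apply: subset_trans sX _; apply/subsetP => e; rewrite inE => /andP[].
have sDG : eset (del_vertex G v) \subset eset G.
  by apply/subsetP => e; rewrite inE => /andP[].
have VX : verts (del_vertex G v) X = verts G X.
  change (\bigcup_(f in eset (del_vertex G v) :&: X) ends G f =
          \bigcup_(f in eset G :&: X) ends G f).
  by rewrite (setIidPr sXD) (setIidPr (subset_trans sXD sDG)).
rewrite VX in leX X0 sXc; exists X; split=> //; first exact: subset_trans sDA.
apply/subsetP => y /(subsetP sXc); rewrite inE => wy; rewrite -(closed_connect _ wy) // => p q.
case/exists_inP => e eD /andP[pe qe]; have eA := subsetP sDA e eD.
by apply/idP/idP => [pW|qW]; apply: (subsetP (clW e _)) => //;
  apply/touchingP; split=> //; [exists p | exists q].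
Qed.

(** Take [B] maximal sparse in [A], and a tight [T] covering the vertices of [A :\: B]. Edges of [A]
    touching a vertex outside [verts G T] all lie in [B :\: T]; by the Hall condition they are at
    least as many as those vertices, and adding the size of [T] gives the bound. *)
Lemma large_sparse G k A : 0 < k -> A \subset eset G -> #|vset G| + k <= #|A|.+1 ->
    (forall W, W \subset vset G -> #|W| <= #|touching G A W|) ->
  exists2 B : {set E}, B \subset A & sparse G k B /\ #|vset G| + k <= #|B|.+1.
Proof.
move=> k_gt0 sAG leA hall.
have [|B /maxsetP[/andP[sBA spB] maxB] _] :=
  @maxset_exists _ (fun X => (X \subset A) && sparse G k X) set0.
  by rewrite sub0set sparse0.
exists B => //; split=> //.
have [/eqP|AB] := eqVneq (A :\: B) set0.
  by rewrite setD_eq0 => /subset_leq_card; move: leA; clear; lia.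
have [|T [sTB /eqP tT sVT]] := maximal_sparse_tight sAG AB spB.
  move=> e /setDP[eA eB]; apply: contra eB => spe.
  by rewrite -(maxB (e |: B)) ?setU11 ?subsetUr // spe subUset sub1set eA sBA.
have := hall (vset G :\: verts G T) (subsetDl _ _).
have : touching G A (vset G :\: verts G T) \subset B :\: T.
  apply/subsetP => e /touchingP[eA [x xe /setDP[_ xT]]].
  have eG := subsetP sAG e eA; rewrite inE; apply/andP; split; apply: contraR xT => He.
    by apply: (subsetP (ends_verts eG _)) xe; apply/negPn.
  apply: (subsetP sVT); apply: (subsetP (ends_verts eG _)) xe.
  by rewrite inE He.
move/subset_leq_card; have := cardsID T B; rewrite (setIidPr sTB).
have := cardsID (verts G T) (vset G); rewrite (setIidPr (verts_subset G T)).
by move: tT; clear; lia.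
Qed.

End Components.

(** * From a star-preserving bijection to a strong isomorphism *)

Section StrongIsomorphism.
Variables V V' E : finType.
Variables (G : graph V E) (G' : graph V' E) (nu : V -> V').
Hypothesis esetE : eset G = eset G'.
Hypothesis nu_inj : {in vset G &, injective nu}.
Hypothesis nu_onto : nu @: vset G = vset G'.
Hypothesis star_nu : {in vset G, forall x, star x G = star (nu x) G'}.

Lemma eq_stars : stars G = stars G'.
Proof. by rewrite /stars -nu_onto -imset_comp; apply: eq_in_imset. Qed.

Lemma mem_ends_nu e x : e \in eset G -> x \in vset G ->
  (x \in ends G e) = (nu x \in ends G' e).
Proof. by move=> eG /star_nu/setP/(_ e); rewrite !mem_star -esetE eG. Qed.

Lemma star_strongly_isomorphic : strongly_isomorphic G G'.
Proof.
split=> //; have nuG (u : {x | x \in vset G}) : nu (val u) \in vset G'.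
  by rewrite -nu_onto imset_f ?(valP u).
pose f (u : {x | x \in vset G}) : {x | x \in vset G'} := Sub (nu (val u)) (nuG u).
exists f; split.
  apply: inj_card_bij => [u w /(congr1 val)/= /nu_inj nuE|].
    by apply/val_inj/nuE; apply: valP.
  by rewrite !card_sig -[X in _ <= X](card_in_imset nu_inj) nu_onto.
move=> e u w eG; split=> /setP endsE; apply/setP => z.
  (* A point [z] outside the vertex set is an end on neither side; the other points are compared
     through [mem_ends_nu]. *)
  have [zG'|zG'] := boolP (z \in vset G').
    have /imsetP[y yG ->] : z \in nu @: vset G by rewrite nu_onto.
    rewrite -mem_ends_nu // endsE !inE !(inj_in_eq nu_inj) //; exact: valP.
  have -> : z \in ends G' e = false.
    by apply: contraNF zG'; apply/subsetP/ends_sub; rewrite -esetE.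
  by rewrite !inE; apply/esym/norP; split; apply: contraNneq zG' => ->; apply: nuG.
have [zG|zG] := boolP (z \in vset G).
  by rewrite mem_ends_nu // endsE !inE !(inj_in_eq nu_inj) //; apply: valP.
have -> : z \in ends G e = false.
  by apply: contraNF zG; apply/subsetP/ends_sub.
by rewrite !inE; apply/esym/norP; split; apply: contraNneq zG => ->; apply: valP.
Qed.

End StrongIsomorphism.

(** * Matching the stars of the two graphs *)

Lemma rank_le (E : finType) (N : matroid E) : rank N <= #|ground N|.
Proof. by apply/bigmax_leqP => I /andP[sIN _]; apply: subset_leq_card. Qed.

Theorem theorem6p2 (k : nat) (V V' E : finType)
    (G : graph V E) (G' : graph V' E) (v : V)
    (k_ge1 : 1 <= k)
    (G_no_isolated : no_isolated G)
    (G'_no_isolated : no_isolated G')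
    (v_in_G : v \in vset G)
    (a1 : connected_matroid (circular_matroid k G))
    (a2 : forall x : V, x \in vset G -> x != v ->
            nonseparating_cocircuit (circular_matroid k G) (star x G))
    (a3 : forall e : E, is_loop G e -> e \in star v G)
    (a4 : #|star v G| <= corank (circular_matroid k G) + 1
          /\ no_tree_component (del_vertex G v))
    (a5 : circular_matroid k G' = circular_matroid k G) :
  stars G = stars G' /\ strongly_isomorphic G G'.
Proof.
have esetE : eset G = eset G' by have /(congr1 (@ground E)) := a5.
have a1' : connected_matroid (circular_matroid k G') by rewrite a5.
have rankG := rank_circular k_ge1 G_no_isolated a1.
have cardV : #|vset G'| = #|vset G|.
  by apply/(@addIn k); rewrite -rankG -a5 (rank_circular k_ge1 G'_no_isolated a1').
have [v0' _] : exists v0', v0' \in vset G'.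
  by apply/set0Pn; rewrite -card_gt0 cardV card_gt0; apply/set0Pn; exists v.
(* The default [v0'] only makes [f] total: away from [v] the choice succeeds by [fP]. *)
pose f x := odflt v0' [pick y in vset G' | star x G == star y G'].
have fP x : x \in vset G :\ v -> f x \in vset G' /\ star x G = star (f x) G'.
  case/setD1P => xv xG; rewrite /f; case: pickP => [y /andP[yG' /eqP] //|noy].
  have nsx := a2 x xG xv; rewrite -a5 in nsx.
  have [y [yG' xy _]] := nonseparating_cocircuit_star k_ge1 G'_no_isolated a1' nsx.
  by have := noy y; rewrite /= yG' xy eqxx.
have star_inj x y : x \in vset G :\ v -> y \in vset G -> star x G = star y G -> x = y.
  case/setD1P => xv xG yG xy.
  have [z [_ _ /setP Vz]] :=
    nonseparating_cocircuit_star k_ge1 G_no_isolated a1 (a2 x xG xv).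
  suff eqz t : t \in vset G -> star x G = star t G -> t = z by rewrite (eqz x) // (eqz y).
  (* A vertex with the same star as [x] is uncovered once that star is deleted, and [z] is the only
     uncovered vertex. *)
  move=> tG xt; apply/eqP; have := Vz t; rewrite in_setD1 tG andbT xt => Et.
  rewrite -[t == z]negbK -Et; apply/mem_verts => -[e /setIP[eG /setDP[_]]].
  by rewrite mem_star eG => /negP.
have f_inj : {in vset G :\ v &, injective f}.
  move=> x y xG yG fxy; have [_ xE] := fP x xG; have [_ yE] := fP y yG.
  by apply: star_inj; rewrite ?xE ?yE ?fxy //; case/setD1P: yG.
have sfG' : f @: (vset G :\ v) \subset vset G'.
  by apply/subsetP => _ /imsetP[x /fP[fx _] ->].
have /cards1P[v' Dv'] : #|vset G' :\: f @: (vset G :\ v)| == 1.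
  have := cardsID (f @: (vset G :\ v)) (vset G').
  rewrite (setIidPr sfG') card_in_imset // cardV (cardsD1 v (vset G)) v_in_G.
  by clear; lia.
have /setDP[v'G' v'f] : v' \in vset G' :\: f @: (vset G :\ v) by rewrite Dv' set11.
have fv' x : x \in vset G :\ v -> f x != v'.
  by move=> xG; apply: contraNneq v'f => <-; apply: imset_f.
(* An edge at [v'] but not at [v] is no loop of [G] by [a3]; its two ends in [G] have distinct
   images under [f], both different from [v'], giving three ends in [G']. *)
have sub_star : star v' G' \subset star v G.
  apply/subsetP => e ev'; apply: contraT => ev.
  have eG : e \in eset G by rewrite esetE; move: ev'; rewrite mem_star => /andP[].
  have /cards2P[x [y [xy endsE]]] : #|ends G e| == 2.
    have := contra (a3 e) ev; rewrite /is_loop eG /=.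
    by have /andP[] := ends_card eG; case: #|_| => [|[|[]]].
  have memD t : t \in ends G e -> t \in vset G :\ v.
    move=> te; rewrite in_setD1 (subsetP (ends_sub eG)) // andbT.
    by apply: contraNneq ev => <-; rewrite mem_star eG.
  have fe t : t \in ends G e -> f t \in ends G' e.
    move=> te; have [_ /setP/(_ e)] := fP t (memD t te).
    by rewrite !mem_star -esetE eG te.
  have xe : x \in ends G e by rewrite endsE set21.
  have ye : y \in ends G e by rewrite endsE set22.
  move: ev'; rewrite mem_star -esetE eG /= => v'e.
  rewrite esetE in eG; have /negP[] := ends_three eG v'e (fe x xe) (fe y ye).
  rewrite /= !inE negb_or ![v' == _]eq_sym !fv' ?memD //= andbT.
  by rewrite (inj_in_eq f_inj) ?memD.
have star_v : star v G = star v' G'.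
  apply/eqP; rewrite eqEsubset sub_star andbT; apply: contraT => /subsetPn[a av av'].
  have [aG va] : a \in eset G /\ v \in ends G a by apply/andP; rewrite -mem_star.
  have aG' : a \in eset G' by rewrite -esetE.
  (* Any end of [a] in [G'] differs from [v'], so it is the image of a second end of [a] in [G]:
     hence [a] is not a loop. *)
  have [x' x'a] := ends_neq0 aG'.
  have /imsetP[x xG x'E] : x' \in f @: (vset G :\ v).
    have x'G' := subsetP (ends_sub aG') x' x'a; apply: contraNT av' => x'f.
    have : x' \in vset G' :\: f @: (vset G :\ v) by rewrite inE x'f.
    by rewrite Dv' => /set1P<-; rewrite mem_star aG'.
  have xa : x \in ends G a.
    have [_ /setP/(_ a)] := fP x xG; rewrite !mem_star aG aG' -x'E x'a.
    by case: (x \in _).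
  have naloop : ~~ is_loop G a.
    rewrite /is_loop aG; apply/cards1P => -[t at1]; have /setD1P[/eqP[]] := xG.
    by move: xa va; rewrite at1 => /set1P-> /set1P->.
  pose A := eset G :\: star v' G'.
  have sAG : A \subset eset G := subsetDl _ _.
  case: a4 => leS notree.
  (* Strict inclusion absorbs the [+ 1] in [a4]: the star of [v'] has at most corank many edges, so
     [A] has at least rank many. [rank_le] makes the truncated subtraction in [corank] exact. *)
  have leA : #|vset G| + k <= #|A|.+1.
    have sS : star v' G' \subset eset G.
      by apply/subsetP => e; rewrite esetE mem_star => /andP[].
    have : #|star v' G'| < #|star v G|.
      by apply: proper_card; apply/properP; split=> //; exists a.
    have := cardsID (star v' G') (eset G); rewrite (setIidPr sS).
    have := rank_le (circular_matroid k G); rewrite -rankG.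
    by move: leS; rewrite /corank /= -/A; move: (rank _); clear; lia.
  have sDA : eset (del_vertex G v) \subset A.
    apply/subsetP => e; rewrite inE => /andP[eG ve]; rewrite inE eG andbT.
    by apply: contra ve => /(subsetP sub_star); rewrite mem_star => /andP[].
  have aA : a \in A by rewrite inE av'.
  have [B sBA [spB leB]] := large_sparse k_ge1 sAG leA
    (card_touching_del_vertex sAG notree sDA aA va naloop).
  (* By [a5] the set [B] is also independent in the matroid of [G'], but there it avoids [v'], and
     one vertex fewer makes it too large. *)
  have : indep (circular_matroid k G') B.
    by rewrite a5 indep_circular // spB (subset_trans sBA).
  rewrite indep_circular // => /andP[_ /sparseP/(_ B (subxx B))].
  have : verts G' B \subset vset G' :\ v'.
    rewrite subsetD1 verts_subset; apply/mem_verts => -[e /setIP[eG' eB] v'e].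
    by have := subsetP sBA e eB; rewrite inE mem_star eG' v'e.
  move/subset_leq_card; have := cardsD1 v' (vset G'); rewrite v'G' cardV.
  by move: leB; clear; lia.
have memGv x : x \in vset G -> x != v -> x \in vset G :\ v by rewrite in_setD1 => -> ->.
pose nu x := if x == v then v' else f x.
have nu_inj : {in vset G &, injective nu}.
  move=> x y xG yG; rewrite /nu.
  have [-> | xv] := eqVneq x v; have [-> | yv] := eqVneq y v => //.
  - by move/esym/eqP; rewrite (negPf (fv' y (memGv y yG yv))).
  - by move/eqP; rewrite (negPf (fv' x (memGv x xG xv))).
  by apply: f_inj; apply: memGv.
have nu_onto : nu @: vset G = vset G'.
  apply/eqP; rewrite eqEcard card_in_imset // cardV leqnn andbT.
  apply/subsetP => _ /imsetP[x xG ->]; rewrite /nu; case: eqVneq => // xv.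
  by have [] := fP x (memGv x xG xv).
have star_nu : {in vset G, forall x, star x G = star (nu x) G'}.
  move=> x xG; rewrite /nu; have [-> //|xv] := eqVneq x v.
  by have [] := fP x (memGv x xG xv).
by split; [apply: eq_stars star_nu | apply: star_strongly_isomorphic star_nu].
Qed.
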